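(* Let $A$ be a normal bounded linear operator on a complex Hilbert space $\mathcal H\neq\{0\}$. Then \[ W_0(A)=\operatorname{conv}\bigl(\sigma(A)\cap\mathcal C_A\bigr), \] where $\mathcal C_A=\{z\in\mathbb C: |z|=\|A\|\}$.
   Context: The maximal numerical range $W_0(A)$ is the set of all $\lambda\in\mathbb C$ for which there exist unit vectors $x_n\in\mathcal H$ with $\|Ax_n\|\to\|A\|$ and $\langle Ax_n,x_n\rangle\to\lambda$. $\sigma(A)$ denotes the spectrum of $A$ and $\operatorname{conv}$ the convex hull. *)

(* Defs.v *)
From HB Require Import structures.
From mathcomp Require Import all_boot all_order all_algebra.
From mathcomp Require Import complex.
From mathcomp Require Import boolp classical_sets reals.
Set Implicit Arguments. Unset Strict Implicit. Unset Printing Implicit Defensive.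
Import Order.TTheory GRing.Theory Num.Theory ComplexField.
Local Open Scope ring_scope.
Local Open Scope complex_scope.
Local Open Scope classical_set_scope.

Section Hilbert.
Variables (R : realType) (H : lmodType R[i]) (ip : H -> H -> R[i]).

Definition is_inner_product : Prop :=
  [/\ forall (a : R[i]) (x y z : H), ip (a *: x + y) z = a * ip x z + ip y z,
      forall x y : H, ip x y = (ip y x)^*,
      forall x : H, 0 <= ip x x
    & forall x : H, ip x x = 0 -> x = 0].

Definition hnorm (x : H) : R := Num.sqrt (complex.Re (ip x x)).

Definition cvgR (u : nat -> R) (l : R) : Prop :=
  forall e : R, 0 < e -> exists N, forall n, (N <= n)%N -> `|u n - l| < e.

Definition cvgC (u : nat -> R[i]) (l : R[i]) : Prop :=
  forall e : R, 0 < e -> exists N, forall n, (N <= n)%N -> `|u n - l| < e%:C.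

Definition hcomplete : Prop :=
  forall u : nat -> H,
    (forall e : R, 0 < e -> exists N, forall m n, (N <= m)%N -> (N <= n)%N ->
        hnorm (u m - u n) < e) ->
    exists l : H, forall e : R, 0 < e -> exists N, forall n, (N <= n)%N ->
        hnorm (u n - l) < e.

Definition is_hilbert : Prop := is_inner_product /\ hcomplete.

Definition linear_op (T : H -> H) : Prop :=
  forall (a : R[i]) (x y : H), T (a *: x + y) = a *: T x + T y.

Definition bounded_op (T : H -> H) : Prop :=
  exists M : R, forall x : H, hnorm (T x) <= M * hnorm x.

Definition is_adjoint (T S : H -> H) : Prop :=
  forall x y : H, ip (T x) y = ip x (S y).

Definition normal_op (T : H -> H) : Prop :=
  exists S : H -> H, is_adjoint T S /\ (forall x, T (S x) = S (T x)).

Definition opnorm (T : H -> H) : R :=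
  sup [set hnorm (T x) | x in [set x : H | hnorm x = 1]].

Definition spectrum (T : H -> H) : set R[i] :=
  [set lam : R[i] | ~ exists B : H -> H,
      [/\ linear_op B, bounded_op B,
          forall x, B (T x - lam *: x) = x
        & forall x, T (B x) - lam *: B x = x]].

Definition max_num_range (T : H -> H) : set R[i] :=
  [set lam : R[i] | exists x : nat -> H,
      [/\ forall n, hnorm (x n) = 1,
          cvgR (fun n => hnorm (T (x n))) (opnorm T)
        & cvgC (fun n => ip (T (x n)) (x n)) lam]].

Definition norm_circle (T : H -> H) : set R[i] :=
  [set z : R[i] | `|z| = (opnorm T)%:C].

End Hilbert.

Definition convex_hull (R : realType) (S : set R[i]) : set R[i] :=
  [set z : R[i] | exists (n : nat) (c : 'I_n -> R) (w : 'I_n -> R[i]),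
      [/\ forall i, S (w i), forall i, 0 <= c i, \sum_(i < n) c i = 1
        & z = \sum_(i < n) (c i)%:C * w i]].

(* Main.v *)
(* For a normal operator A with adjoint S, the spectrum consists of approximate
   eigenvalues: if A - v is bounded below then (A - v)^* (A - v) is coercive,
   hence onto by a contraction argument, and A - v is invertible.

   Hull in range: for distinct eigenvalues v of modulus ||A||, approximate
   eigenvectors y_v are almost orthogonal, so x = sum sqrt(c_v) y_v is almost a
   unit vector with <A x, x> close to sum c_v v and ||A x|| close to ||A||.

   Range in hull: if ||A x_n|| -> ||A|| then S A x_n - ||A||^2 x_n -> 0.  For a
   unit scalar u, maximizing the form of B = Re (u^* A) over the approximate
   kernel of S A - ||A||^2 produces approximate joint eigenvectors of B and S A,
   and these yield a point of the spectrum on the circle which is at least as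
   far in the direction u as any point of the range.  A point of the plane that
   is dominated in every direction by a compact set lies in its convex hull. *)
Require Import Defs.
From HB Require Import structures.
From mathcomp Require Import all_boot all_order all_algebra.
From mathcomp Require Import complex.
From mathcomp Require Import boolp classical_sets reals.
From mathcomp Require Import topology normedtype sequences derive.
From mathcomp Require Import ring lra.
Import Order.TTheory GRing.Theory Num.Theory ComplexField Normc.
Import numFieldNormedType.Exports.
Local Open Scope ring_scope.
Local Open Scope complex_scope.
Local Open Scope classical_set_scope.

Set Implicit Arguments.
Unset Strict Implicit.
Unset Printing Implicit Defensive.

(** * Real-valued modulus of complex numbers *)

Section ComplexModulus.
Variable R : realType.
Implicit Types (a v w : R[i]).

Lemma normC_normc a : `|a| = (normc a)%:C. Proof. by []. Qed.

Lemma realcM (r s : R) : (r * s)%:C = r%:C * s%:C :> R[i].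
Proof. exact: rmorphM. Qed.

Lemma realcB (r s : R) : (r - s)%:C = r%:C - s%:C :> R[i].
Proof. exact: rmorphB. Qed.

Lemma normc_ge0 a : 0 <= normc a.
Proof. by case: a => a b; exact: sqrtr_ge0. Qed.

Lemma mulcJ a : a * conjc a = (normc a ^+ 2)%:C.
Proof. by rewrite -sqr_normc normC_normc rmorphXn. Qed.

Lemma Re_le_normc a : complex.Re a <= normc a.
Proof.
have := normc_ge_Re a; rewrite normC_normc lecR; exact/le_trans/ler_norm.
Qed.

Lemma normRe_le_normc a : `|complex.Re a| <= normc a.
Proof. by have := normc_ge_Re a; rewrite normC_normc lecR. Qed.

Lemma ReD (a b : R[i]) : complex.Re (a + b) = complex.Re a + complex.Re b.
Proof. by case: a; case: b. Qed.

Lemma ReB (a b : R[i]) : complex.Re (a - b) = complex.Re a - complex.Re b.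
Proof. by case: a; case: b. Qed.

Lemma ReJ a : complex.Re (conjc a) = complex.Re a.
Proof. by case: a. Qed.

Lemma ler_normcD v w : normc (v + w) <= normc v + normc w.
Proof. exact: le_normcD. Qed.

Lemma ler_normcB v w : normc (v - w) <= normc v + normc w.
Proof. by rewrite -(normcN w); exact: le_normcD. Qed.

Lemma normc_sum (I : finType) (F : I -> R[i]) :
  normc (\sum_i F i) <= \sum_i normc (F i).
Proof.
elim/big_ind2 : _ => [|r v s w hv hw|//]; first by rewrite normc0.
apply: le_trans (ler_normcD v w) _; exact: lerD.
Qed.

Lemma normc_real (r : R) : normc r%:C = `|r|.
Proof. by rewrite /normc /= expr0n addr0 sqrtr_sqr. Qed.

End ComplexModulus.

(** * Inner product identities and the induced norm *)

Section InnerProduct.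
Variables (R : realType) (H : lmodType R[i]) (ip : H -> H -> R[i]).
Hypothesis ipP : is_inner_product ip.
Implicit Types (x y z : H) (a : R[i]).

Lemma ip_conj x y : ip x y = (ip y x)^*.
Proof. by case: ipP. Qed.

Lemma ipDl x y z : ip (x + y) z = ip x z + ip y z.
Proof. by case: ipP => h _ _ _; rewrite -{1}[x]scale1r h mul1r. Qed.

Lemma ip0l z : ip 0 z = 0.
Proof. by apply: (addrI (ip 0 z)); rewrite -ipDl !addr0. Qed.

Lemma ipZl a x z : ip (a *: x) z = a * ip x z.
Proof. by case: ipP => h _ _ _; rewrite -[a *: x]addr0 h ip0l addr0. Qed.

Lemma ipNl x z : ip (- x) z = - ip x z.
Proof. by rewrite -scaleN1r ipZl mulN1r. Qed.

Lemma ipBl x y z : ip (x - y) z = ip x z - ip y z.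
Proof. by rewrite ipDl ipNl. Qed.

Lemma ip_suml (I : finType) (F : I -> H) z :
  ip (\sum_i F i) z = \sum_i ip (F i) z.
Proof. by apply: (big_morph (ip^~ z)) => [x y|]; [exact: ipDl|exact: ip0l]. Qed.

Lemma ipDr x y z : ip z (x + y) = ip z x + ip z y.
Proof. by rewrite ip_conj ipDl rmorphD /= -!ip_conj. Qed.

Lemma ip0r z : ip z 0 = 0.
Proof. by rewrite ip_conj ip0l conjc0. Qed.

Lemma ipZr a x z : ip z (a *: x) = conjc a * ip z x.
Proof. by rewrite ip_conj ipZl rmorphM /= -ip_conj. Qed.

Lemma ipNr x z : ip z (- x) = - ip z x.
Proof. by rewrite ip_conj ipNl rmorphN /= -ip_conj. Qed.

Lemma ipBr x y z : ip z (x - y) = ip z x - ip z y.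
Proof. by rewrite ipDr ipNr. Qed.

Lemma ip_sumr (I : finType) (F : I -> H) z :
  ip z (\sum_i F i) = \sum_i ip z (F i).
Proof. by apply: (big_morph (ip z)) => [x y|]; [exact: ipDr|exact: ip0r]. Qed.

Definition ipE := (ipDl, ipDr, ipBl, ipBr, ipNl, ipNr, ipZl, ipZr).

Lemma ip_ge0 x : 0 <= ip x x.
Proof. by case: ipP. Qed.

Lemma hnorm_ge0 x : 0 <= hnorm ip x.
Proof. exact: sqrtr_ge0. Qed.

Lemma hnorm_sqr x : hnorm ip x ^+ 2 = complex.Re (ip x x).
Proof.
by rewrite sqr_sqrtr //; have := ip_ge0 x; rewrite lecE => /andP[].
Qed.

Lemma ipxx x : ip x x = (hnorm ip x ^+ 2)%:C.
Proof.
rewrite hnorm_sqr; have := ger0_Im (ip_ge0 x).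
by case: (ip x x) => a b /= ->.
Qed.

Lemma hnorm0 : hnorm ip 0 = 0.
Proof. by rewrite /hnorm ip0l sqrtr0. Qed.

Lemma hnorm_eq0 x : (hnorm ip x == 0) = (x == 0).
Proof.
apply/eqP/eqP => [h|->]; last exact: hnorm0.
by case: ipP => _ _ _; apply; rewrite ipxx h expr0n.
Qed.

Lemma hnormZ a x : hnorm ip (a *: x) = normc a * hnorm ip x.
Proof.
apply/eqP; rewrite -(@eqrXn2 _ 2) ?mulr_ge0 ?hnorm_ge0 ?normc_ge0 //.
apply/eqP/complexI; rewrite -ipxx ipZl ipZr ipxx mulrA mulcJ exprMn.
by rewrite -realcM.
Qed.

Lemma hnormZR (r : R) x : 0 <= r -> hnorm ip (r%:C *: x) = r * hnorm ip x.
Proof.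
by move=> r0; rewrite hnormZ /normc /= expr0n addr0 sqrtr_sqr ger0_norm.
Qed.

Lemma hnormN x : hnorm ip (- x) = hnorm ip x.
Proof. by rewrite /hnorm ipNl ipNr opprK. Qed.

Lemma hnormBC x y : hnorm ip (x - y) = hnorm ip (y - x).
Proof. by rewrite -hnormN opprB. Qed.

(** Follows from positivity of the form at [r x - a y] with [r = |y|^2] and [a = <x, y>]; scaling
    [x] by [r] avoids a division. *)
Lemma cauchy_schwarz x y : normc (ip x y) <= hnorm ip x * hnorm ip y.
Proof.
have [->|y0] := eqVneq y 0; first by rewrite ip0r hnorm0 mulr0 normc0.
rewrite -(@ler_pXn2r _ 2) ?nnegrE ?mulr_ge0 ?hnorm_ge0 ?normc_ge0 //.
set r := hnorm ip y ^+ 2; set a := ip x y.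
have r0 : 0 < r by rewrite exprn_gt0 // lt_neqAle eq_sym hnorm_eq0 y0 hnorm_ge0.
have := ip_ge0 (r%:C *: x - a *: y).
have -> : ip (r%:C *: x - a *: y) (r%:C *: x - a *: y) =
    (r * (r * hnorm ip x ^+ 2 - normc a ^+ 2))%:C.
  rewrite !ipE (ip_conj y x) -/a !ipxx -/r.
  rewrite !conjc_real.
  by rewrite [RHS]realcM realcB (realcM r) -mulcJ; ring.
rewrite ler0c pmulr_rge0 // subr_ge0 exprMn -/r => /le_trans; apply.
by rewrite mulrC.
Qed.

Lemma hnormD_sqr x y : hnorm ip (x + y) ^+ 2 =
  hnorm ip x ^+ 2 + 2 * complex.Re (ip x y) + hnorm ip y ^+ 2.
Proof.
rewrite !hnorm_sqr !ipE !ReD (ip_conj y x) ReJ; ring.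
Qed.

Lemma hnormB_sqr x y : hnorm ip (x - y) ^+ 2 =
  hnorm ip x ^+ 2 - 2 * complex.Re (ip x y) + hnorm ip y ^+ 2.
Proof.
by rewrite hnormD_sqr hnormN ipNr; case: (ip x y) => a b /=; rewrite mulrN.
Qed.

Lemma hnormD x y : hnorm ip (x + y) <= hnorm ip x + hnorm ip y.
Proof.
rewrite -(@ler_pXn2r _ 2) ?nnegrE ?addr_ge0 ?hnorm_ge0 // hnormD_sqr.
have := le_trans (Re_le_normc _) (cauchy_schwarz x y); nra.
Qed.

Lemma hnormB x y : hnorm ip (x - y) <= hnorm ip x + hnorm ip y.
Proof. by rewrite -(hnormN y) hnormD. Qed.

Lemma hnorm_dist x y : hnorm ip x <= hnorm ip (x - y) + hnorm ip y.
Proof. by rewrite -{1}(subrK y x) hnormD. Qed.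

Lemma ip_inj x y : (forall z, ip z x = ip z y) -> x = y.
Proof.
move=> h; apply/eqP; rewrite -subr_eq0 -hnorm_eq0 -sqrf_eq0 hnorm_sqr.
by rewrite ipBr h subrr.
Qed.

Lemma unit_vector x : x != 0 -> hnorm ip ((hnorm ip x)^-1%:C *: x) = 1.
Proof.
move=> x0; rewrite hnormZR ?invr_ge0 ?hnorm_ge0 // mulVf //.
by rewrite hnorm_eq0.
Qed.

End InnerProduct.

(** * Linear operators, adjoints and the shifts [T - v] *)

Section Operators.
Variables (R : realType) (H : lmodType R[i]) (ip : H -> H -> R[i]).
Hypothesis ipP : is_inner_product ip.
Implicit Types (x y z : H) (T S : H -> H) (v : R[i]).

Lemma linear_opD T (lT : linear_op T) x y : T (x + y) = T x + T y.
Proof. by rewrite -{1}[x]scale1r lT scale1r. Qed.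

Lemma linear_op0 T (lT : linear_op T) : T 0 = 0.
Proof. by apply: (addrI (T 0)); rewrite -(linear_opD lT) !addr0. Qed.

Lemma linear_opZ T (lT : linear_op T) v x : T (v *: x) = v *: T x.
Proof. by rewrite -[v *: x]addr0 lT (linear_op0 lT) addr0. Qed.

Lemma linear_opB T (lT : linear_op T) x y : T (x - y) = T x - T y.
Proof. by rewrite (linear_opD lT) -scaleN1r (linear_opZ lT) scaleN1r. Qed.

Lemma linear_op_sum T (I : finType) (F : I -> H) :
  linear_op T -> T (\sum_i F i) = \sum_i T (F i).
Proof.
move=> h; apply: (big_morph T) => [x y|]; [exact: linear_opD|exact: linear_op0].
Qed.

Lemma is_adjointC T S : is_adjoint ip T S -> is_adjoint ip S T.
Proof. by move=> h x y; rewrite ip_conj // -h -ip_conj. Qed.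

Lemma adjoint_linear T S : is_adjoint ip T S -> linear_op S.
Proof.
by move=> h a x y; apply: (ip_inj ipP) => z; rewrite -h !(ipE ipP) -!h.
Qed.

(** The two squared norms are [<T S x, x>] and [<S T x, x>], which agree by commutation. *)
Lemma normal_hnorm T S x : is_adjoint ip T S -> (forall x, T (S x) = S (T x)) ->
  hnorm ip (S x) = hnorm ip (T x).
Proof. by move=> h c; rewrite /hnorm -h c (is_adjointC h). Qed.

Definition shift_op T v x := T x - v *: x.

Lemma linear_shift T v : linear_op T -> linear_op (shift_op T v).
Proof.
move=> h a x y; rewrite /shift_op h scalerBr !scalerDr !scalerA mulrC.
by rewrite addrACA opprD.
Qed.

Lemma adjoint_shift T S v : is_adjoint ip T S ->
  is_adjoint ip (shift_op T v) (shift_op S (conjc v)).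
Proof. by move=> h x y; rewrite !(ipE ipP) h conjcK. Qed.

Lemma commute_shift T S v w : linear_op T -> linear_op S ->
  (forall x, T (S x) = S (T x)) ->
  forall x, shift_op T v (shift_op S w x) = shift_op S w (shift_op T v x).
Proof.
move=> lT lS c x; rewrite /shift_op (linear_opB lT) (linear_opB lS).
rewrite (linear_opZ lT) (linear_opZ lS) c.
rewrite !scalerBr !scalerA (mulrC v) !opprB addrACA [RHS]addrACA.
by congr (_ + _); rewrite addrC.
Qed.

End Operators.

(** * Contractions and surjectivity of coercive operators *)

Section FixedPoint.
Variables (R : realType) (H : lmodType R[i]) (ip : H -> H -> R[i]).
Hypotheses (ipP : is_inner_product ip) (cpl : hcomplete ip).
Implicit Types (x y z : H).

Lemma expr_lt_eps (q e : R) : 0 <= q < 1 -> 0 < e ->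
  exists N, forall n, (N <= n)%N -> q ^+ n < e.
Proof.
move=> /andP[q0 q1] e0.
have /cvg_expr h : `|q| < 1 by rewrite ger0_norm.
have [N _ hN] := (cvgrPdist_lt _ _).1 h e e0.
by exists N => n /hN /=; rewrite sub0r normrN ger0_norm // exprn_ge0.
Qed.

(** Banach iteration from 0. The radius [D] solves [|G 0| + q D = D], so all iterates stay in the
    ball of radius [D], and applying [G] n times gives [|u (n + k) - u n| <= q^n D] without summing
    a geometric series. *)
Lemma contraction_fixpoint (G : H -> H) (q : R) : 0 <= q < 1 ->
  (forall x y, hnorm ip (G x - G y) <= q * hnorm ip (x - y)) ->
  exists x, G x = x.
Proof.
move=> q01 hG; have /andP[q0 q1] := q01.
pose u n := iter n G 0; pose D := hnorm ip (G 0) / (1 - q).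
have D0 : 0 <= D by rewrite divr_ge0 ?hnorm_ge0 // subr_ge0 ltW.
have DE : hnorm ip (G 0) + q * D = D by rewrite /D; field; lra.
have uD k : hnorm ip (u k) <= D.
  elim: k => [|k IH]; first by rewrite hnorm0.
  rewrite -DE addrC; apply: le_trans (hnorm_dist ipP _ (G 0)) _.
  rewrite lerD2r; apply: le_trans (hG _ _) _.
  by rewrite subr0; apply: ler_wpM2l.
have ud n k : hnorm ip (u (n + k)%N - u n) <= q ^+ n * D.
  elim: n => [|n IH]; first by rewrite subr0 expr0 mul1r add0n.
  rewrite exprS -mulrA; apply: le_trans (hG _ _) _; exact: ler_wpM2l.
have [|l hl] := @cpl u.
  move=> e e0; have [|N hN] := @expr_lt_eps q (e / (D + 1)) q01.
    by rewrite divr_gt0 //; lra.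
  have hsmall n : (N <= n)%N -> q ^+ n * D < e.
    move=> /hN; rewrite ltr_pdivlMr; last by lra.
    by have := exprn_ge0 n q0; nra.
  exists N => m n Nm Nn; have [mn|/ltnW nm] := leqP m n.
    rewrite hnormBC // -(subnKC mn).
    exact: le_lt_trans (ud _ _) (hsmall _ Nm).
  by rewrite -(subnKC nm); exact: le_lt_trans (ud _ _) (hsmall _ Nn).
exists l; apply/eqP; rewrite -subr_eq0 -(hnorm_eq0 ipP) eq_le hnorm_ge0 andbT.
apply/ler_addgt0Pl => e e0; rewrite addr0.
have [|N hN] := hl (e / 2); first by lra.
have h1 := hN _ (leqnn N); have h2 := hN _ (leqnSn N).
have := hnormD ipP (G l - u N.+1) (u N.+1 - l); rewrite addrA subrK.
have := hG l (u N); rewrite -/(u N.+1) (hnormBC ipP l); nra.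
Qed.

(** A solution of [T x = y] is a fixed point of [x - s (T x - y)]. With [s = c / K^2], [|w - s T
    w|^2 <= (1 - 2 s c + s^2 K^2) |w|^2 = (1 - s c) |w|^2], so this map is a contraction. *)
Lemma coercive_surjective (T : H -> H) (c L : R) : linear_op T -> 0 < c ->
  (forall x, c * hnorm ip x ^+ 2 <= complex.Re (ip (T x) x)) ->
  (forall x, hnorm ip (T x) <= L * hnorm ip x) ->
  forall y, exists x, T x = y.
Proof.
(* Adding [c] to the bound makes [K] positive and at least [c], hence [s c <= 1] and the square root
   [q] is meaningful. *)
move=> lT c0 hc hL y; pose K := `|L| + c; pose s := c / K ^+ 2.
have K0 : 0 < K by rewrite ltr_wpDl.
have cK : c <= K by rewrite lerDr.
have hK x : hnorm ip (T x) <= K * hnorm ip x.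
  apply: le_trans (hL x) _; apply: ler_wpM2r; first exact: hnorm_ge0.
  by apply: le_trans (ler_norm L) _; rewrite lerDl ltW.
have s0 : 0 < s by rewrite divr_gt0 ?exprn_gt0.
have sK : s * K ^+ 2 = c by rewrite divfK // gt_eqF ?exprn_gt0.
pose q := Num.sqrt (1 - s * c).
have sc1 : s * c <= 1.
  rewrite /s mulrAC ler_pdivrMr ?exprn_gt0 // mul1r -expr2.
  by rewrite ler_pXn2r // nnegrE ltW.
have q2 : q ^+ 2 = 1 - s * c by rewrite sqr_sqrtr // subr_ge0.
have q0 : 0 <= q by exact: sqrtr_ge0.
have q1 : q < 1.
  by rewrite -(@ltr_pXn2r _ 2) ?nnegrE // q2 expr1n; have := mulr_gt0 s0 c0; lra.
pose G x := x - s%:C *: (T x - y).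
have [||x hx] := @contraction_fixpoint G q; first by rewrite q0.
  move=> x z; have -> : G x - G z = (x - z) - s%:C *: T (x - z).
    rewrite /G (linear_opB lT) opprB [s%:C *: _ - z]addrC addrACA.
    by rewrite [X in _ + X]addrC -scalerBr opprB addrA subrK -scalerN opprB.
  set w := x - z.
  rewrite -(@ler_pXn2r _ 2) ?nnegrE ?mulr_ge0 ?hnorm_ge0 //.
  rewrite exprMn q2 hnormB_sqr // (hnormZR ipP _ (ltW s0)) exprMn.
  have -> : complex.Re (ip w (s%:C *: T w)) = s * complex.Re (ip (T w) w).
    rewrite ipZr // conjc_real (ip_conj ipP w); case: (ip (T w) w) => a b /=.
    by rewrite mul0r subr0.
  have h1 := hc w; have h2 := hK w.
  have h3 : hnorm ip (T w) ^+ 2 <= K ^+ 2 * hnorm ip w ^+ 2.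
    by rewrite -exprMn ler_pXn2r ?nnegrE ?mulr_ge0 ?hnorm_ge0 // ltW.
  have h4 : s ^+ 2 * hnorm ip (T w) ^+ 2 <= s * (c * hnorm ip w ^+ 2).
    rewrite -sK expr2 -mulrA; apply: ler_wpM2l; first exact: ltW.
    by rewrite -mulrA; apply: ler_wpM2l => //; exact: ltW.
  have h5 : s * (c * hnorm ip w ^+ 2) <= s * complex.Re (ip (T w) w).
    by apply: ler_wpM2l => //; exact: ltW.
  lra.
exists x; move/eqP: hx; rewrite /G -subr_eq0 addrAC subrr add0r oppr_eq0.
rewrite scaler_eq0 subr_eq0 => /orP[/eqP[] sE|/eqP//].
by rewrite sE ltxx in s0.
Qed.

End FixedPoint.

(** * Approximate eigenvalues, spectrum and operator norm *)

Section Spectrum.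
Variables (R : realType) (H : lmodType R[i]) (ip : H -> H -> R[i]).
Hypotheses (ipP : is_inner_product ip).
Implicit Types (x y z : H) (T : H -> H) (v : R[i]).

(** Stated with tolerances rather than sequences, so that its negation is directly a lower bound for
    [T - v]. *)
Definition approx_eigenvalue T v := forall e : R, 0 < e ->
  exists x, hnorm ip x = 1 /\ hnorm ip (shift_op T v x) < e.

Lemma not_approx_eigenvalue T v : linear_op T -> ~ approx_eigenvalue T v ->
  exists2 c : R, 0 < c &
    forall x, c * hnorm ip x <= hnorm ip (shift_op T v x).
Proof.
move=> lT /existsNP[c /not_implyP[c0 /forallNP hc]]; exists c => // x.
have [->|x0] := eqVneq x 0; first by rewrite hnorm0 // mulr0 hnorm_ge0.
have nx0 : 0 < hnorm ip x by rewrite lt_neqAle eq_sym hnorm_eq0 // x0 hnorm_ge0.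
rewrite leNgt; apply/negP => h; apply: (hc ((hnorm ip x)^-1%:C *: x)).
split; first exact: unit_vector.
rewrite (linear_opZ (linear_shift _ lT)) hnormZR ?invr_ge0 ?hnorm_ge0 //.
by rewrite mulrC ltr_pdivrMr.
Qed.

Lemma approx_eigenvalue_spectrum T v :
  approx_eigenvalue T v -> spectrum ip T v.
Proof.
move=> hv [B [lB [M hM] BT TB]].
(* With this tolerance, [1 = |B (T - v) x| <= M |(T - v) x| < 1]. *)
have [|x [x1 hx]] := hv (`|M| + 1)^-1; first by rewrite invr_gt0 ltr_wpDl.
have := hM (shift_op T v x); rewrite BT x1.
have := ler_norm M; have := normr_ge0 M; have := hnorm_ge0 ip (shift_op T v x).
have : hnorm ip (shift_op T v x) * (`|M| + 1) < 1.
  by rewrite -ltr_pdivlMr ?div1r // ltr_wpDl.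
nra.
Qed.

(** By contraposition: with [D = T - v] bounded below by [c] and [D'] its adjoint, [D' D] is
    coercive with constant [c^2], hence onto. Since [|D' x| = |D x|], [D'] is injective, and solving
    [D' D x = D' y] gives [D x = y]. The lower bound also bounds the inverse by [c^-1]. *)
Lemma spectrum_approx_eigenvalue T v : hcomplete ip ->
  linear_op T -> bounded_op ip T -> normal_op ip T ->
  spectrum ip T v -> approx_eigenvalue T v.
Proof.
move=> cpl lT [M hM] [S [adj com]]; apply: contraPP => nv; apply.
have [c c0 hc] := not_approx_eigenvalue lT nv.
have lS := adjoint_linear ipP adj.
have lD := linear_shift v lT; have lD' := linear_shift (conjc v) lS.
have adjD := adjoint_shift ipP v adj.
have comD := commute_shift v (conjc v) lT lS com.
set D := shift_op T v in hc lD adjD comD *.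
set D' := shift_op S (conjc v) in lD' adjD comD *.
have nD' x : hnorm ip (D' x) = hnorm ip (D x) by exact: normal_hnorm.
have injD x : D x = 0 -> x = 0.
  move=> Dx; apply/eqP; rewrite -(hnorm_eq0 ipP) eq_le hnorm_ge0 andbT.
  by rewrite -(pmulr_rle0 _ c0); have := hc x; rewrite Dx hnorm0.
have nD x : hnorm ip (D x) <= (`|M| + normc v) * hnorm ip x.
  apply: le_trans (hnormB ipP _ _) _; rewrite hnormZ // mulrDl lerD2r.
  apply: le_trans (hM x) _; apply: ler_wpM2r; [exact: hnorm_ge0|exact: ler_norm].
have surjD y : exists x, D x = y.
  have [||||x hx] := @coercive_surjective _ _ _ ipP cpl (D' \o D) (c ^+ 2)
    ((`|M| + normc v) ^+ 2) _ _ _ _ (D' y).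
  - by move=> a x z /=; rewrite lD lD'.
  - exact: exprn_gt0.
  - move=> x /=; rewrite (is_adjointC ipP adjD) ipxx //= -exprMn.
    by rewrite ler_pXn2r ?nnegrE ?mulr_ge0 ?hnorm_ge0 // ltW.
  - move=> x /=; rewrite nD' expr2 -mulrA; apply: le_trans (nD _) _.
    by apply: ler_wpM2l => //; rewrite addr_ge0 ?normc_ge0.
  exists x; apply/eqP; rewrite -subr_eq0; apply/eqP/injD/eqP.
  rewrite -(hnorm_eq0 ipP) -nD' (linear_opB lD') -[D' (D x)]/((D' \o D) x) hx.
  by rewrite subrr hnorm0.
have [B hB] := choice surjD; exists B.
have injD2 x y : D x = D y -> x = y.
  move=> e; apply/eqP; rewrite -subr_eq0; apply/eqP/injD.
  by rewrite (linear_opB lD) e subrr.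
split=> [a x y|||//].
- by apply: injD2; rewrite lD !hB.
- exists c^-1 => x; rewrite -ler_pdivrMl ?invr_gt0 // invrK.
  by rewrite -{2}(hB x).
- by move=> x; apply: injD2; rewrite hB.
Qed.

Lemma hnorm_opnorm T x : linear_op T -> bounded_op ip T ->
  hnorm ip (T x) <= opnorm ip T * hnorm ip x.
Proof.
move=> lT [M hM]; have [->|x0] := eqVneq x 0.
  by rewrite (linear_op0 lT) hnorm0 // mulr0.
have nx0 : 0 < hnorm ip x by rewrite lt_neqAle eq_sym hnorm_eq0 // x0 hnorm_ge0.
rewrite -ler_pdivrMr // mulrC.
rewrite -hnormZR ?invr_ge0 ?hnorm_ge0 // -(linear_opZ lT).
apply: ub_le_sup; last by exists ((hnorm ip x)^-1%:C *: x) => //; exact: unit_vector.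
by exists M => _ [y y1 <-]; rewrite (le_trans (hM y)) // y1 mulr1.
Qed.

Lemma opnorm_ge0 T : linear_op T -> bounded_op ip T -> (exists x : H, x != 0) ->
  0 <= opnorm ip T.
Proof.
move=> lT bT [x /(unit_vector ipP) x1].
have := hnorm_opnorm ((hnorm ip x)^-1%:C *: x) lT bT; rewrite x1 mulr1.
exact/le_trans/hnorm_ge0.
Qed.

End Spectrum.

(** * From convex combinations of approximate eigenvalues to the maximal numerical range *)

Section Combination.
Variables (R : realType) (H : lmodType R[i]) (ip : H -> H -> R[i]).
Hypotheses (ipP : is_inner_product ip).
Implicit Types (x y z : H) (T : H -> H) (v w : R[i]).

(** Expanding [<T x, x>] gives a double sum of the deviations [F i j] of [<T (y i), y j>] from the
    diagonal matrix of the [d i]. Each deviation is at most [C e] from the eigenvalue equation plus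
    [D e] from near orthogonality, and the weights [sqrt (c i) sqrt (c j)] are at most 1. Leaving
    [T] and [d] free lets one estimate also control [|x|] and [|T x|]. *)
Lemma eigenvector_combination (I : finType) (c : I -> R) (d : I -> R[i])
    (y : I -> H) T (C D e : R) x : x = \sum_i (Num.sqrt (c i))%:C *: y i ->
  linear_op T -> 0 <= e -> 0 <= C -> 0 <= D -> (forall i, 0 <= c i <= 1) ->
  (forall i, hnorm ip (y i) = 1) ->
  (forall i j, i != j -> normc (ip (y i) (y j)) <= e) ->
  (forall i, hnorm ip (T (y i) - d i *: y i) <= C * e) ->
  (forall i, normc (d i) <= D) ->
  normc (ip (T x) x - \sum_i (c i)%:C * d i) <= (#|I| * #|I|)%:R * ((C + D) * e).
Proof.
move=> xE lT e0 C0 D0 c01 y1 yo yT dD.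
set a := fun i => Num.sqrt (c i).
pose F i j := ip (T (y i)) (y j) - (i == j)%:R * d i.
have Fe i j : normc (F i j) <= (C + D) * e.
  have -> : F i j =
      ip (T (y i) - d i *: y i) (y j) + d i * (ip (y i) (y j) - (i == j)%:R).
    by rewrite /F (ipBl ipP) (ipZl ipP); ring.
  apply: le_trans (ler_normcD _ _) _; rewrite mulrDl; apply: lerD.
    by apply: le_trans (cauchy_schwarz ipP _ _) _; rewrite y1 mulr1.
  rewrite normcM; apply: ler_pM; rewrite ?normc_ge0 //.
  have [->|ij] := eqVneq i j; last by rewrite subr0 yo.
  by rewrite ipxx // y1 expr1n subrr normc0.
have -> : ip (T x) x - \sum_i (c i)%:C * d i =
    \sum_i \sum_j (a i * a j)%:C * F i j.
  rewrite xE (linear_op_sum _ lT) (ip_suml ipP) -sumrB; apply: eq_bigr => i _.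
  rewrite (linear_opZ lT) (ipZl ipP) (ip_sumr ipP) mulr_sumr.
  have -> : (c i)%:C * d i = \sum_j (a i * a j)%:C * ((i == j)%:R * d i).
    rewrite (bigD1 i) //= eqxx mul1r big1 ?addr0 => [|j /negbTE ji].
      by rewrite -expr2 sqr_sqrtr //; case/andP: (c01 i).
    by rewrite eq_sym ji mul0r mulr0.
  rewrite -sumrB; apply: eq_bigr => j _.
  by rewrite (ipZr ipP) conjc_real /F realcM; ring.
have a01 i : 0 <= a i <= 1.
  by rewrite sqrtr_ge0 -sqrtr1 ler_sqrt //; case/andP: (c01 i).
apply: le_trans (normc_sum _) _.
have -> : (#|I| * #|I|)%:R * ((C + D) * e) = \sum_(i : I) \sum_(j : I) (C + D) * e.
  by rewrite !sumr_const -mulrnA mulr_natl.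
apply: ler_sum => i _; apply: le_trans (normc_sum _) _; apply: ler_sum => j _.
have /andP[ai0 ai1] := a01 i; have /andP[aj0 aj1] := a01 j.
rewrite normcM normc_real ger0_norm ?mulr_ge0 // -[leRHS]mul1r.
by apply: ler_pM; rewrite ?normc_ge0 ?mulr_ge0 // mulr_ile1.
Qed.

(* Approximate eigenvectors of a normal operator for distinct eigenvalues are
   almost orthogonal, since (v - w)<y, z> = <(v - A)y, z> + <y, (A* - w^* )z>. *)
Lemma approx_eigenvectors T S (I : finType) (w : I -> R[i]) (e : R) :
  is_adjoint ip T S -> (forall x, T (S x) = S (T x)) -> linear_op T ->
  injective w -> (forall i, approx_eigenvalue ip T (w i)) -> 0 < e ->
  exists y : I -> H, [/\ forall i, hnorm ip (y i) = 1,
    forall i, hnorm ip (shift_op T (w i) (y i)) <= e &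
    forall i j, i != j -> normc (ip (y i) (y j)) <= e].
Proof.
move=> adj com lT wI wT e0.
(* [g] is a lower bound for the gaps between distinct values; the default 1 keeps it positive when
   there is no pair. With residuals at most [e g / 2], the two terms of the identity add up to at
   most [e g <= e |w i - w j|]. *)
pose g : R := \big[Num.min/1]_(p : I * I | p.1 != p.2) normc (w p.1 - w p.2).
have g0 : 0 < g.
  apply: lt_bigmin => [|[i j] /= ij]; first exact: ltr01.
  rewrite lt_neqAle normc_ge0 andbT eq_sym; apply/eqP => /eq0_normc /eqP.
  by rewrite subr_eq0 => /eqP/wI/eqP; exact/negP.
have gw i j : i != j -> g <= normc (w i - w j).
  by move=> ij; exact: (@bigmin_le_cond _ _ _ _ (i, j) (fun p => p.1 != p.2)).
pose d := Num.min e (e * g / 2).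
have d0 : 0 < d by rewrite lt_min e0 divr_gt0 // mulr_gt0.
have [y hy] := choice (fun i => wT i d d0).
have y1 i : hnorm ip (y i) = 1 by case: (hy i).
exists y; split=> [//|i|i j ij].
  by case: (hy i) => _ /ltW /le_trans; apply; rewrite ge_min lexx.
have {}hy k : hnorm ip (shift_op T (w k) (y k)) <= e * g / 2.
  by case: (hy k) => _ /ltW /le_trans; apply; rewrite ge_min lexx orbT.
have {}hyS k : hnorm ip (shift_op S (conjc (w k)) (y k)) <= e * g / 2.
  rewrite (normal_hnorm ipP _ (adjoint_shift ipP (w k) adj)) //.
  exact: (commute_shift _ _ lT (adjoint_linear ipP adj) com).
have wij : 0 < normc (w i - w j) by apply: lt_le_trans g0 (gw _ _ ij).
rewrite -(ler_pM2l wij) -normcM.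
have -> : (w i - w j) * ip (y i) (y j) =
    ip (y i) (shift_op S (conjc (w j)) (y j)) - ip (shift_op T (w i) (y i)) (y j).
  by rewrite /shift_op !(ipE ipP) conjcK adj; ring.
apply: le_trans (ler_normcB _ _) _.
have := cauchy_schwarz ipP (y i) (shift_op S (conjc (w j)) (y j)).
have := cauchy_schwarz ipP (shift_op T (w i) (y i)) (y j).
rewrite !y1 mul1r mulr1; have := hy i; have := hyS j; have := gw _ _ ij.
have : 0 <= e * (normc (w i - w j) - g) by rewrite mulr_ge0 ?subr_ge0 ?gw ?ltW.
lra.
Qed.

(** Allows vectors that are only nearly unit: they are normalized at a controlled cost, and the
    tolerances [1 / (n + 1)] then yield the required sequence. *)
Lemma max_num_range_approx T v : linear_op T -> bounded_op ip T ->
  0 <= opnorm ip T ->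
  (forall e : R, 0 < e -> exists x, [/\ `|hnorm ip x ^+ 2 - 1| <= e,
     `|hnorm ip (T x) ^+ 2 - opnorm ip T ^+ 2| <= e &
     normc (ip (T x) x - v) <= e]) ->
  max_num_range ip T v.
Proof.
move=> lT bT; set M := opnorm ip T => M0 h.
have {h} unitP (e : R) : 0 < e -> exists x, [/\ hnorm ip x = 1,
    `|hnorm ip (T x) - M| < e & normc (ip (T x) x - v) < e].
  move=> e0; pose K := 2 + M ^+ 2 + normc v.
  have K2 : 2 <= K by rewrite /K -addrA lerDl addr_ge0 ?sqr_ge0 ?normc_ge0.
  (* The bound by [e^2] serves the norm: with [b] the norm of the image of the normalized vector,
     [0 <= b <= M] gives [(M - b)^2 <= M^2 - b^2 <= f (1 + M^2)]. The bound by [e] serves the value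
     of the form. *)
  pose f := Num.min (e / 3) (e ^+ 2 / 3) / K.
  have f0 : 0 < f by rewrite divr_gt0 ?lt_min ?divr_gt0 ?exprn_gt0 //; lra.
  have fK1 : f * K <= e / 3 by rewrite divfK ?ge_min ?lexx //; lra.
  have fK2 : f * K <= e ^+ 2 / 3 by rewrite divfK ?ge_min ?lexx ?orbT //; lra.
  (* The cap 1/2 forces [|x|^2 >= 1/2], so [x] is nonzero and normalizing at most doubles the error
     in the form. *)
  have [|x] := h (Num.min f (1 / 2)); first by rewrite lt_min f0; lra.
  rewrite !le_min => -[/andP[n1 n2] /andP[t1 _] /andP[i1 _]].
  set n := hnorm ip x ^+ 2 in n1 n2.
  have n0 : 1 / 2 <= n by move: n2; rewrite ler_norml; lra.
  have x0 : x != 0.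
    by apply: contraTneq n0 => x0; rewrite /n x0 hnorm0 // expr0n /=; lra.
  exists ((hnorm ip x)^-1%:C *: x); split; first exact: unit_vector.
    set x' := _ *: x; have Mx' : hnorm ip (T x') <= M.
      by have := hnorm_opnorm ipP x' lT bT; rewrite unit_vector // mulr1.
    have Tx : hnorm ip (T x) ^+ 2 = n * hnorm ip (T x') ^+ 2.
      rewrite /x' (linear_opZ lT) hnormZR ?invr_ge0 ?hnorm_ge0 //.
      by rewrite exprMn exprVn mulrA mulfV ?mul1r // sqrf_eq0 hnorm_eq0.
    rewrite distrC ger0_norm ?subr_ge0 //.
    rewrite -(@ltr_pXn2r _ 2) ?nnegrE ?subr_ge0 ?(ltW e0) //.
    move: t1 n1; rewrite Tx !ler_norml => /andP[t1 _] /andP[_ n1].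
    have b0 := hnorm_ge0 ip (T x'); set b := hnorm ip (T x') in b0 Mx' t1 *.
    have : (n - 1) * b ^+ 2 <= f * M ^+ 2.
      apply: (@le_trans _ _ (f * b ^+ 2)); first by rewrite ler_wpM2r ?sqr_ge0.
      by rewrite ler_wpM2l ?(ltW f0) // ler_pXn2r ?nnegrE.
    have : (M - b) ^+ 2 <= M ^+ 2 - b ^+ 2 by nra.
    have : 0 <= f * normc v by rewrite mulr_ge0 ?normc_ge0 ?(ltW f0).
    have : 0 < e ^+ 2 by rewrite exprn_gt0.
    move: fK2; rewrite /K !mulrDr; lra.
  rewrite (linear_opZ lT) (ipZl ipP) (ipZr ipP) conjc_real.
  have -> : (hnorm ip x)^-1%:C * ((hnorm ip x)^-1%:C * ip (T x) x) - v =
      n^-1%:C * ((ip (T x) x - v) - (n - 1)%:C * v).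
    have -> : n^-1%:C = (hnorm ip x)^-1%:C * (hnorm ip x)^-1%:C :> R[i].
      by rewrite -realcM -expr2 exprVn.
    have : n^-1%:C * n%:C = 1 :> R[i] by rewrite -realcM mulVf //; lra.
    have -> : n^-1%:C = (hnorm ip x)^-1%:C * (hnorm ip x)^-1%:C :> R[i].
      by rewrite -realcM -expr2 exprVn.
    rewrite realcB; set r := (hnorm ip x)^-1%:C => rn.
    rewrite -[v in LHS]mul1r -rn; ring.
  rewrite normcM normc_real ger0_norm; last by rewrite invr_ge0; lra.
  rewrite mulrC ltr_pdivrMr; last by lra.
  apply: le_lt_trans (ler_normcB _ _) _; rewrite normcM normc_real.
  have : `|n - 1| * normc v <= f * normc v by rewrite ler_wpM2r ?normc_ge0.
  have : 0 <= f * M ^+ 2 by rewrite mulr_ge0 ?sqr_ge0 ?(ltW f0).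
  have : e * (1 / 2) <= e * n by rewrite ler_wpM2l ?(ltW e0).
  move: fK1; rewrite /K !mulrDr; lra.
have inv0 n : 0 < n.+1%:R^-1 :> R by rewrite invr_gt0 ltr0n.
have [x hx] := choice (fun n : nat => unitP _ (inv0 n)).
have small (e : R) : 0 < e -> exists N, forall n, (N <= n)%N -> n.+1%:R^-1 < e.
  move=> e0; exists (Num.bound e^-1) => n Nn.
  rewrite invf_plt ?posrE ?ltr0n //; apply: lt_le_trans (archi_boundP _) _.
    by rewrite invr_ge0 ltW.
  by rewrite ler_nat ltnW.
exists x; split=> [n|e /small[N hN]|e /small[N hN]]; first by case: (hx n).
  by exists N => n /hN; case: (hx n) => _ h _; exact: lt_trans h.
by exists N => n /hN hn; rewrite normC_normc ltcR; case: (hx n) => _ _ /lt_trans; apply.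
Qed.

(** [eigenvector_combination] is applied to the identity with eigenvalue 1, to [S T] with eigenvalue
    [M^2], and to [T] with eigenvalues [w i]; these control [|x|^2], [|T x|^2 = <S T x, x>] and
    [<T x, x>]. *)
Lemma approx_hull_max_num_range T S (I : finType) (c : I -> R) (w : I -> R[i]) :
  is_adjoint ip T S -> (forall x, T (S x) = S (T x)) ->
  linear_op T -> bounded_op ip T -> 0 <= opnorm ip T -> injective w ->
  (forall i, approx_eigenvalue ip T (w i)) ->
  (forall i, normc (w i) = opnorm ip T) ->
  (forall i, 0 <= c i) -> \sum_i c i = 1 ->
  max_num_range ip T (\sum_i (c i)%:C * w i).
Proof.
move=> adj com lT bT M0 wI wT wM c0 c1; apply: max_num_range_approx => // e e0.
have lS := adjoint_linear ipP adj.
set M := opnorm ip T in M0 wM *.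
have c01 i : 0 <= c i <= 1.
  by rewrite c0 -c1 (bigD1 i) //= lerDl sumr_ge0.
pose N : R := (#|I| * #|I|)%:R.
have N0 : 0 <= N by exact: ler0n.
(* The three summands are the constants [C + D] of the three applications; the final 1 keeps [K]
   positive. *)
pose K := N * (1 + (1 + M) + (2 * M + M ^+ 2)) + 1.
have K0 : 0 < K by rewrite ltr_wpDl // mulr_ge0 // ?addr_ge0 ?mulr_ge0 ?sqr_ge0.
have f0 : 0 < e / K by exact: divr_gt0.
have Kf : K * (e / K) = e by rewrite mulrC divfK // gt_eqF.
set f := e / K in f0 Kf.
have [y [y1 yT yo]] := approx_eigenvectors adj com lT wI wT f0.
have Nf B : 0 <= B -> B <= 1 + (1 + M) + (2 * M + M ^+ 2) -> N * (B * f) <= e.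
  move=> B0 hB; rewrite -[leRHS]Kf mulrA ler_wpM2r ?(ltW f0) //.
  by rewrite /K ler_wpDr // ler_wpM2l.
have M2 : 0 <= M ^+ 2 by exact: sqr_ge0.
pose x := \sum_i (Num.sqrt (c i))%:C *: y i; exists x.
have comb := fun d T' C D => @eigenvector_combination I c d y T' C D f x erefl.
split.
- have := comb (fun=> 1) id 0 1; rewrite -/N => /(_ _ (ltW f0) _ _ c01 y1 yo) h.
  have {h} : normc (ip x x - \sum_i (c i)%:C * 1) <= N * ((0 + 1) * f).
    apply: h => // i; last by rewrite normc1.
    by rewrite scale1r subrr hnorm0 // mul0r.
  under eq_bigr do rewrite mulr1.
  rewrite -rmorph_sum /= c1 ipxx // -realcB normc_real => /le_trans; apply.
  by apply: Nf; lra.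
- have := comb (fun=> (M ^+ 2)%:C) (S \o T) (2 * M) (M ^+ 2).
  rewrite -/N => /(_ _ (ltW f0) _ _ c01 y1 yo) h.
  have {h} : normc (ip (S (T x)) x - \sum_i (c i)%:C * (M ^+ 2)%:C)
      <= N * ((2 * M + M ^+ 2) * f).
    apply: h => // [a z z'||i|i]; rewrite ?mulr_ge0 //.
    + by rewrite /= lT lS.
    (* As [w i] times its conjugate is [M^2], the residual of [S T] splits into those of [T] and
       [S]; each contributes at most [M f], whence [C = 2 M]. *)
    + have -> : S (T (y i)) - (M ^+ 2)%:C *: y i =
          S (shift_op T (w i) (y i)) + w i *: shift_op S (conjc (w i)) (y i).
        rewrite /shift_op (linear_opB lS) (linear_opZ lS) scalerBr scalerA.
        by rewrite mulcJ wM addrA subrK.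
      have nS z : hnorm ip (S z) <= M * hnorm ip z.
        by rewrite (normal_hnorm ipP _ adj com); exact: hnorm_opnorm.
      apply: le_trans (hnormD ipP _ _) _; rewrite hnormZ // wM.
      rewrite (normal_hnorm ipP _ (adjoint_shift ipP (w i) adj)); last first.
        exact: commute_shift.
      have := nS (shift_op T (w i) (y i)); have := ler_wpM2l M0 (yT i); lra.
    + by rewrite normc_real ger0_norm.
  rewrite -mulr_suml -rmorph_sum /= c1 mul1r (is_adjointC ipP adj) ipxx //.
  rewrite -realcB normc_real => /le_trans; apply.
  by apply: Nf; lra.
- have := comb w T 1 M; rewrite -/N => /(_ lT (ltW f0) _ _ c01 y1 yo) h.
  apply: le_trans (h _ _ _ _) _ => //.
  + by move=> i; rewrite mul1r; exact: yT.
  + by move=> i; rewrite wM.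
  by apply: Nf; lra.
Qed.

End Combination.

(** * Spectral points on the circle that dominate the range in a given direction *)

Section SupportPoint.
Variables (R : realType) (H : lmodType R[i]) (ip : H -> H -> R[i]).
Hypotheses (ipP : is_inner_product ip).
Implicit Types (x y z : H) (T S B N : H -> H) (v w u : R[i]).

(** Self-adjointness makes both cross terms equal to [s |B x|^2]: moving along [B x] raises the form
    to first order. *)
Lemma selfadjoint_form_line B (s : R) x : linear_op B -> is_adjoint ip B B ->
  complex.Re (ip (B (x + s%:C *: B x)) (x + s%:C *: B x)) =
  complex.Re (ip (B x) x) + 2 * s * hnorm ip (B x) ^+ 2
    + s ^+ 2 * complex.Re (ip (B (B x)) (B x)).
Proof.
move=> lB adjB; rewrite (linear_opD lB) (linear_opZ lB) !(ipE ipP).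
rewrite (adjB (B x) x) (ipxx ipP (B x)) conjc_real.
by case: (ip (B x) x) (ip (B (B x)) (B x)) => p q [p' q'] /=; ring.
Qed.

(* [b] is the largest approximate value of the form of [B] on the approximate
   kernel of [N].  For a nearly maximizing [x], moving along [B x - b x], which
   stays in the approximate kernel, would raise the value above [b] unless
   [B x - b x] is small. *)
Lemma joint_approx_eigenvector B N (M r : R) :
  linear_op B -> linear_op N -> is_adjoint ip B B ->
  (forall x, N (B x) = B (N x)) -> 0 <= M ->
  (forall x, hnorm ip (B x) <= M * hnorm ip x) ->
  (forall d : R, 0 < d -> exists x, [/\ hnorm ip x = 1, hnorm ip (N x) <= d &
    r - d <= complex.Re (ip (B x) x)]) ->
  exists2 b : R, r <= b & forall d : R, 0 < d ->
    exists x, [/\ hnorm ip x = 1, hnorm ip (N x) <= d &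
      hnorm ip (shift_op B b%:C x) <= d].
Proof.
move=> lB lN adjB com M0 hM hr.
pose Q (b : R) := forall d : R, 0 < d -> exists x,
  [/\ hnorm ip x = 1, hnorm ip (N x) <= d & b - d <= complex.Re (ip (B x) x)].
have QM (b : R) : Q b -> b <= M.
  move=> hb; apply/ler_addgt0Pl => d d0; have [x [x1 _ hx]] := hb d d0.
  have := le_trans (Re_le_normc _) (cauchy_schwarz ipP (B x) x).
  by have := hM x; rewrite x1 !mulr1; lra.
have supQ : has_sup Q by split; [exists r | exists M => b /QM].
pose b := sup Q.
have Qb : Q b.
  move=> d d0; have d20 : 0 < d / 2 by lra.
  have [c Qc bc] := sup_adherent d20 supQ.
  have [x [x1 Nx Bx]] := Qc _ d20; exists x; split=> //; first by lra.
  by rewrite -/b in bc; lra.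
exists b => [|h h0]; first exact: sup_upper_bound.
pose L := M + `|b| + 1.
have L1 : 1 <= L by rewrite lerDr addr_ge0.
(* The bound [h / 2] pays for passing from [b + e] back to [b], the bound [h^2 / (12 L)] yields
   [|y| <= h / 2] at the end, and the bound 1 keeps [L] a norm bound for [B - (b + e)]. *)
pose e := Num.min (Num.min 1 (h / 2)) (h ^+ 2 / (12 * L)).
have e0 : 0 < e.
  by rewrite !lt_min ltr01 !divr_gt0 ?exprn_gt0 //; lra.
have e1 : e <= 1 by rewrite /e !ge_min lexx.
have eh : e <= h / 2 by rewrite /e !ge_min lexx orbT.
have eh2 : e * (12 * L) <= h ^+ 2.
  by rewrite -ler_pdivlMr /e ?ge_min ?lexx ?orbT //; lra.
(* As [b] is the supremum, [b + e] fails [Q]: for some [d], no unit [x] with [|N x| <= d] has form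
   value at least [b + e - d]. *)
clearbody e; have : ~ Q (b + e) by move=> /(sup_upper_bound supQ); rewrite -/b; lra.
move=> /existsNP[d /not_implyP[d0 /forallNP hd]].
pose D := shift_op B (b + e)%:C.
have lD : linear_op D by exact: linear_shift.
have adjD : is_adjoint ip D D.
  by have := adjoint_shift ipP (b + e)%:C adjB; rewrite conjc_real.
have DL x : hnorm ip (D x) <= L * hnorm ip x.
  apply: le_trans (hnormB ipP _ _) _; rewrite hnormZ // normc_real.
  have : `|b + e| <= `|b| + 1.
    by apply: le_trans (ler_normD _ _) _; rewrite lerD2l ger0_norm // ltW.
  have := hM x; have := hnorm_ge0 ip x; rewrite /L; nra.
have ND x : N (D x) = D (N x).
  by rewrite /D /shift_op (linear_opB lN) (linear_opZ lN) com.
have D_le0 z : hnorm ip (N z) <= d * hnorm ip z -> complex.Re (ip (D z) z) <= 0.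
  move=> Nz; have [->|z0] := eqVneq z 0; first by rewrite ip0r.
  have nz0 : 0 < hnorm ip z by rewrite lt_neqAle eq_sym hnorm_eq0 // z0 hnorm_ge0.
  rewrite leNgt; apply/negP => Dz.
  apply: (hd ((hnorm ip z)^-1%:C *: z)); split; first exact: unit_vector.
    rewrite (linear_opZ lN) hnormZR ?invr_ge0 ?hnorm_ge0 //.
    by rewrite mulrC ler_pdivrMr.
  rewrite (linear_opZ lB) (ipZl ipP) (ipZr ipP) conjc_real mulrA -realcM.
  rewrite -expr2 exprVn; set n := hnorm ip z ^+ 2.
  have n0 : 0 < n by exact: exprn_gt0.
  have : b + e <= n^-1 * complex.Re (ip (B z) z).
    rewrite mulrC ler_pdivlMr //; move: Dz.
    rewrite /D /shift_op (ipBl ipP) (ipZl ipP) ReB ipxx // -/n /=.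
    by rewrite mul0r subr0 => ?; lra.
  case: (ip (B z) z) => p q /=; rewrite mul0r subr0; lra.
(* With [s L = 1/2] below, [|N z| <= (3/2) d' <= d / 2 <= d |z|], so [z] is still subject to
   [D_le0]. *)
pose d' := Num.min (Num.min h e) (d / 3).
have d'0 : 0 < d' by rewrite !lt_min h0 e0; lra.
have d'h : d' <= h by rewrite /d' !ge_min lexx.
have d'e : d' <= e by rewrite /d' !ge_min lexx orbT.
have d'd : d' <= d / 3 by rewrite /d' !ge_min lexx !orbT.
have [x [x1 Nx Bx]] := Qb d' d'0; exists x; split=> //; first by lra.
pose s := (2 * L)^-1.
have s0 : 0 < s by rewrite invr_gt0; lra.
have sL : s * L = 1 / 2 by rewrite /s; field; lra.
pose y := D x; pose z := x + s%:C *: y.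
have yL : hnorm ip y <= L by have := DL x; rewrite x1 mulr1.
have z12 : 1 / 2 <= hnorm ip z.
  have := hnormB ipP z (s%:C *: y); rewrite addrK x1 hnormZR ?(ltW s0) //.
  have : s * hnorm ip y <= s * L by rewrite ler_wpM2l ?(ltW s0).
  lra.
have Nz : hnorm ip (N z) <= d * hnorm ip z.
  rewrite (linear_opD lN) (linear_opZ lN) ND.
  have := hnormD ipP (N x) (s%:C *: D (N x)); rewrite hnormZR ?(ltW s0) //.
  have : s * hnorm ip (D (N x)) <= s * (L * hnorm ip (N x)).
    by rewrite ler_wpM2l ?(ltW s0).
  rewrite mulrA sL; have : d * (1 / 2) <= d * hnorm ip z by rewrite ler_wpM2l ?(ltW d0).
  lra.
have := D_le0 _ Nz.
have -> : complex.Re (ip (D z) z) = complex.Re (ip (D x) x)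
    + 2 * s * hnorm ip y ^+ 2 + s ^+ 2 * complex.Re (ip (D y) y).
  exact: selfadjoint_form_line.
have Dx : - (d' + e) <= complex.Re (ip (D x) x).
  rewrite /D /shift_op (ipBl ipP) (ipZl ipP) ReB ipxx // x1 expr1n /=; lra.
have Dy : - (L * hnorm ip y ^+ 2) <= complex.Re (ip (D y) y).
  have := le_trans (normRe_le_normc _) (cauchy_schwarz ipP (D y) y).
  rewrite ler_norml => /andP[+ _]; apply: le_trans; rewrite lerN2 expr2 mulrA.
  by rewrite ler_wpM2r ?hnorm_ge0.
have sDy : - (s * (1 / 2) * hnorm ip y ^+ 2) <= s ^+ 2 * complex.Re (ip (D y) y).
  rewrite -sL expr2 -!mulrA -2!mulrN; do 2! (apply: ler_wpM2l; first exact: ltW).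
  exact: Dy.
move=> hz.
(* The quadratic term costs at most [(s / 2) |y|^2] of the gain [2 s |y|^2], so
   [(3/2) s |y|^2 <= d' + e <= 2 e]. *)
have {}hz : s * hnorm ip y ^+ 2 <= 4 / 3 * e by lra.
have y2 : hnorm ip y ^+ 2 <= (h / 2) ^+ 2.
  have : 2 * L * (s * hnorm ip y ^+ 2) <= 2 * L * (4 / 3 * e).
    by rewrite ler_wpM2l //; lra.
  rewrite mulrA /s mulfV ?mul1r; last by lra.
  have : 0 <= L * e by rewrite mulr_ge0 //; lra.
  move: eh2; lra.
have {}y2 : hnorm ip y <= h / 2.
  by rewrite -(@ler_pXn2r _ 2) ?nnegrE ?hnorm_ge0 //; lra.
have -> : shift_op B b%:C x = y + e%:C *: x.
  by rewrite /y /D /shift_op rmorphD /= scalerDl opprD addrA subrK.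
apply: le_trans (hnormD ipP _ _) _; rewrite hnormZR ?(ltW e0) // x1; lra.
Qed.

(* The real part [B] of [u^* T] satisfies [2 u B = T + u^2 S], so a vector with
   [B x] close to [b x] and [S T x] close to [M^2 x] nearly kills
   [(T - u m) (T - u m^* )], where [m = b + i sqrt (M^2 - b^2)]. *)
Lemma max_num_range_support T S u v :
  is_adjoint ip T S -> (forall x, T (S x) = S (T x)) ->
  linear_op T -> bounded_op ip T -> 0 <= opnorm ip T ->
  normc u = 1 -> max_num_range ip T v ->
  exists w, [/\ approx_eigenvalue ip T w, normc w = opnorm ip T &
    complex.Re (conjc u * v) <= complex.Re (conjc u * w)].
Proof.
move=> adj com lT bT; set M := opnorm ip T => M0 u1 [x [x1 cT cip]].
rewrite -/M in cT.
have lS := adjoint_linear ipP adj.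
have TM z : hnorm ip (T z) <= M * hnorm ip z by exact: hnorm_opnorm.
have SM z : hnorm ip (S z) <= M * hnorm ip z by rewrite (normal_hnorm ipP _ adj com).
have uu : conjc u * u = 1 by rewrite mulrC mulcJ u1 expr1n.
pose P := S \o T; have lP : linear_op P by move=> a z z'; rewrite /P /= lT lS.
pose N := shift_op P (M ^+ 2)%:C; have lN : linear_op N by exact: linear_shift.
pose B z := (2^-1)%:C *: (conjc u *: T z + u *: S z).
have lB : linear_op B.
  move=> a z z'; rewrite /B lT lS !scalerDr !scalerA addrACA.
  by congr (_ + _ + _); congr (_ *: _); ring.
have adjB : is_adjoint ip B B.
  move=> z z'; rewrite /B !(ipE ipP) adj (is_adjointC ipP adj) conjcK conjc_real.
  ring.
have Re_B z : complex.Re (ip (B z) z) = complex.Re (conjc u * ip (T z) z).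
  rewrite /B !(ipE ipP) (is_adjointC ipP adj) (ip_conj ipP z).
  by case: (ip (T z) z) (u) => p q [p' q'] /=; field.
have BM z : hnorm ip (B z) <= M * hnorm ip z.
  rewrite /B hnormZR ?invr_ge0 //.
  have := hnormD ipP (conjc u *: T z) (u *: S z).
  have -> : hnorm ip (conjc u *: T z) = hnorm ip (T z).
    rewrite hnormZ //; have -> : normc (conjc u) = normc u.
      by case: (u) => p q /=; rewrite sqrrN.
    by rewrite u1 mul1r.
  rewrite hnormZ // u1 mul1r.
  have := TM z; have := SM z; lra.
have comNB z : N (B z) = B (N z).
  have PT z' : P (T z') = T (P z') by rewrite /P /= com.
  have PS z' : P (S z') = S (P z') by rewrite /P /= com.
  have PB : P (B z) = B (P z).
    by rewrite /B (linear_opZ lP) (linear_opD lP) !(linear_opZ lP) PT PS.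
  by rewrite /N /shift_op (linear_opB lB) (linear_opZ lB) PB.
(* Hence norm-maximizing sequences lie in the approximate kernel of [N]. *)
have N2 z : hnorm ip z = 1 ->
    hnorm ip (N z) ^+ 2 <= M ^+ 2 * (M ^+ 2 - hnorm ip (T z) ^+ 2).
  move=> z1; rewrite /N /shift_op hnormB_sqr // hnormZR ?sqr_ge0 // z1 mulr1.
  have -> : complex.Re (ip (P z) ((M ^+ 2)%:C *: z)) = M ^+ 2 * hnorm ip (T z) ^+ 2.
    by rewrite (ipZr ipP) conjc_real (is_adjointC ipP adj) ipxx //= mulr0 subr0.
  have : hnorm ip (P z) ^+ 2 <= M ^+ 2 * hnorm ip (T z) ^+ 2.
    by rewrite -exprMn ler_pXn2r ?nnegrE ?mulr_ge0 ?hnorm_ge0 //; exact: SM.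
  lra.
have [d d0|b vb hb] :=
    @joint_approx_eigenvector B N M (complex.Re (conjc u * v)) lB lN adjB comNB M0 BM.
  (* If [M - t <= d^2 / K], then [M^2 (M^2 - t^2) <= 2 M^3 (M - t) <= d^2]. *)
  pose K := 2 * M ^+ 3 + 1.
  have K0 : 0 < K by rewrite ltr_wpDl // mulr_ge0 // exprn_ge0.
  have [|n1 hn1] := cT (d ^+ 2 / K); first by rewrite divr_gt0 // exprn_gt0.
  have [n2 hn2] := cip d d0.
  pose n := maxn n1 n2; exists (x n); split=> //.
    rewrite -(@ler_pXn2r _ 2) ?nnegrE ?hnorm_ge0 ?(ltW d0) //.
    apply: le_trans (N2 _ (x1 n)) _.
    have := hn1 n (leq_maxl _ _); rewrite ltr_norml => /andP[+ _].
    have := TM (x n); rewrite x1 mulr1; have := hnorm_ge0 ip (T (x n)).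
    set t := hnorm ip _; set f := d ^+ 2 / K => t0 tM tf.
    have Kf : f * K = d ^+ 2 by rewrite divfK // gt_eqF.
    have f0 : 0 < f by rewrite divr_gt0 // exprn_gt0.
    have h1 : M ^+ 2 - t ^+ 2 <= f * (2 * M) by rewrite subr_sqr; apply: ler_pM; lra.
    apply: le_trans (ler_wpM2l (sqr_ge0 M) h1) _.
    by rewrite -Kf /K; lra.
  have := hn2 n (leq_maxr _ _); rewrite normC_normc ltcR => hn.
  rewrite Re_B; have := normRe_le_normc (conjc u * (ip (T (x n)) (x n) - v)).
  rewrite normcM; have -> : normc (conjc u) = 1.
    by rewrite -u1; case: (u) => p q /=; rewrite sqrrN.
  rewrite mul1r mulrBr ReB ler_norml => /andP[+ _]; lra.
(* An approximate eigenvalue of [B] is bounded by its norm bound; this makes [M^2 - b^2] nonnegative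
   and [g] its true square root. *)
have bM : `|b| <= M.
  apply/ler_addgt0Pl => d d0; have [z [z1 _ Bz]] := hb d d0.
  have := hnormB ipP (B z) (shift_op B b%:C z).
  rewrite /shift_op opprB addrC subrK hnormZ // normc_real z1 mulr1.
  by have := BM z; rewrite z1 mulr1 => *; rewrite /shift_op in Bz; lra.
pose g := Num.sqrt (M ^+ 2 - b ^+ 2).
have g2 : g ^+ 2 = M ^+ 2 - b ^+ 2.
  by rewrite sqr_sqrtr // subr_ge0 -(real_normK (num_real b)) ler_pXn2r ?nnegrE.
pose m := b +i* g.
have mM (m' : R[i]) : complex.Re m' = b -> complex.Im m' ^+ 2 = g ^+ 2 ->
    normc (u * m') = M /\ complex.Re (conjc u * (u * m')) = b.
  case: m' => p q /= -> qg; rewrite mulrA uu mul1r; split=> //.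
  by rewrite normcM u1 mul1r /normc qg g2 addrC subrK sqrtr_sqr ger0_norm.
have [m1 m2] := mM m erefl erefl.
have [m'1 m'2] := mM (conjc m) erefl (sqrrN _).
suff [h|h] : approx_eigenvalue ip T (u * m) \/ approx_eigenvalue ip T (u * conjc m).
- by exists (u * m); split=> //; rewrite m2.
- by exists (u * conjc m); split=> //; rewrite m'2.
apply: contrapT => /not_orP[/(not_approx_eigenvalue ipP lT)[c c0 hc]].
move=> /(not_approx_eigenvalue ipP lT)[c' c'0 hc'].
(* If neither point were an approximate eigenvalue, the product of the two shifts would be at least
   [c c'] on unit vectors. That product is [2 u T (B - b) - u^2 N], of norm at most
   [(2 M + 1) d = c c' / 2] at [z]. *)
pose d := c * c' / (2 * (2 * M + 1)).
have d0 : 0 < d by rewrite divr_gt0 ?mulr_gt0 //; lra.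
have dE : (2 * M + 1) * d = c * c' / 2 by rewrite /d; field; lra.
have [z [z1 Nz Bz]] := hb d d0.
have : c * c' <= hnorm ip (shift_op T (u * m) (shift_op T (u * conjc m) z)).
  apply: le_trans (hc _); rewrite ler_wpM2l ?(ltW c0) //.
  by have := hc' z; rewrite z1 mulr1.
have -> : shift_op T (u * m) (shift_op T (u * conjc m) z) =
    (2 * u) *: T (shift_op B b%:C z) - u ^+ 2 *: N z.
  have msum : u * m + u * conjc m = 2 * u * b%:C.
    by rewrite -mulrDr addcJ; ring.
  have mprod : u * m * (u * conjc m) = u ^+ 2 * (M ^+ 2)%:C.
    have -> : (M ^+ 2)%:C = m * conjc m.
      rewrite mulcJ sqr_sqrtr ?addr_ge0 ?sqr_ge0 // g2; congr _%:C; ring.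
    ring.
  rewrite /N /P /shift_op /B /= !(linear_opB lT) !(linear_opZ lT).
  rewrite (linear_opD lT) !(linear_opZ lT) com !scalerBr !scalerDr !scalerA.
  rewrite mprod -msum.
  have -> : 2 * u * ((2^-1)%:C * conjc u) = 1.
    transitivity (conjc u * u * (2 * (2^-1)%:C)); first by ring.
    have -> : (2^-1)%:C = 2^-1 :> R[i] by rewrite fmorphV rmorph_nat.
    by rewrite uu mul1r mulfV ?pnatr_eq0.
  have -> : 2 * u * ((2^-1)%:C * u) = u ^+ 2.
    have -> : (2^-1)%:C = 2^-1 :> R[i] by rewrite fmorphV rmorph_nat.
    by field.
  rewrite scale1r scalerDl opprB !opprD.
  set a1 := T (T z); set a2 := u ^+ 2 *: S (T z).
  set a3 := (u * conjc m) *: T z; set a4 := (u * m) *: T z; set a5 := _ *: z.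
  rewrite opprK [RHS]addrA (addrAC (a1 + a2)) addrK.
  by rewrite [a5 - a4]addrC [- a4 - a3]addrC !addrA.
apply/negP; rewrite -ltNge; apply: le_lt_trans (hnormB ipP _ _) _.
rewrite !hnormZ // !normcM u1 !mulr1 mul1r.
have -> : normc (2 : R[i]) = 2 by rewrite -(rmorph_nat (real_complex R)) normc_real ger0_norm.
have := TM (shift_op B b%:C z); have := ler_wpM2l M0 Bz; have := mulr_gt0 c0 c'0.
rewrite mulrDl mul1r in dE; lra.
Qed.

End SupportPoint.

(** * Stability of hulls under segments, and a crossing argument in the plane *)

Section Planar.
Variable R : realType.
Implicit Types (S : set R[i]) (z w : R[i]).

Lemma sub_convex_hull S z : S z -> convex_hull S z.
Proof.
move=> Sz; exists 1%N, (fun=> 1), (fun=> z).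
by split=> //; rewrite big_ord1 ?mul1r.
Qed.

(** The two families are concatenated, with weights scaled by [1 - s] and [s]. *)
Lemma convex_hull_conv S z w (s : R) : 0 <= s <= 1 ->
  convex_hull S z -> convex_hull S w ->
  convex_hull S ((1 - s)%:C * z + s%:C * w).
Proof.
move=> /andP[s0 s1] [n [c [f [fS c0 c1 ->]]]] [n' [c' [f' [f'S c'0 c'1 ->]]]].
exists (n + n')%N.
exists (fun i => match fintype.split i with inl j => (1 - s) * c j | inr j => s * c' j end).
exists (fun i => match fintype.split i with inl j => f j | inr j => f' j end).
have splitl i : fintype.split (lshift n' i) = inl i :> 'I_n + 'I_n' by exact: (unsplitK (inl i)).
have splitr i : fintype.split (rshift n i) = inr i :> 'I_n + 'I_n' by exact: (unsplitK (inr i)).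
split.
- by move=> i; case: fintype.split.
- by move=> i; case: fintype.split => j; rewrite mulr_ge0 // subr_ge0.
- rewrite big_split_ord /=.
  under eq_bigr do rewrite splitl; under [X in _ + X]eq_bigr do rewrite splitr.
  by rewrite -!mulr_sumr c1 c'1 !mulr1 subrK.
- rewrite big_split_ord /= !mulr_sumr.
  by congr (_ + _); apply: eq_bigr => i _; rewrite ?splitl ?splitr realcM mulrA.
Qed.

(* Moving along the segment from [k] to [k3], the projection on [p] decreases
   strictly, and the segment crosses the line through 0 and [p] at a point
   which cannot be closer to 0 than [p], hence beyond 0. *)
Lemma segment_crosses_opposite_ray (px py kx ky k3x k3y : R) :
  let n := px ^+ 2 + py ^+ 2 in
  0 < n -> px * kx + py * ky = n -> px * k3x + py * k3y <= 0 ->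
  (px * ky - py * kx) * (px * k3y - py * k3x) <= 0 ->
  (forall s, 0 <= s <= 1 ->
    n <= ((1 - s) * kx + s * k3x) ^+ 2 + ((1 - s) * ky + s * k3y) ^+ 2) ->
  exists s r : R, [/\ 0 <= s <= 1, 0 <= r,
    (1 - s) * kx + s * k3x + r * px = 0 & (1 - s) * ky + s * k3y + r * py = 0].
Proof.
move=> n n0; set a := px * ky - py * kx; set b := px * k3y - py * k3x.
set d := px * k3x + py * k3y => kn d0 ab hmin.
have n_neq0 : n != 0 by rewrite gt_eqF.
have kxE : n * kx = n * px - a * py by rewrite -[in RHS]kn /a /n; ring.
have kyE : n * ky = n * py + a * px by rewrite -[in RHS]kn /a /n; ring.
(* [a] and [b] are the cross products of [p] with [k] and [k3]. If [a = 0] then [k = p], and the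
   point at parameter [n / (n + m)] is strictly closer to 0 than [p], a contradiction. *)
have [a0|a_neq0] := eqVneq a 0.
  have kx_px : kx = px by apply: (mulfI n_neq0); rewrite kxE a0; ring.
  have ky_py : ky = py by apply: (mulfI n_neq0); rewrite kyE a0; ring.
  pose m := k3x ^+ 2 + k3y ^+ 2; pose s := n / (n + m).
  have m0 : 0 <= m by rewrite addr_ge0 ?sqr_ge0.
  have sE : s * (n + m) = n by rewrite divfK //; lra.
  have s0 : 0 < s by rewrite divr_gt0 //; lra.
  have s1 : s <= 1 by rewrite ler_pdivrMr; lra.
  have := hmin s; rewrite s1 (ltW s0) => /(_ isT).
  have -> : ((1 - s) * kx + s * k3x) ^+ 2 + ((1 - s) * ky + s * k3y) ^+ 2 =
      n - 2 * s * n + s * (s * (n + m)) + 2 * (s * (1 - s)) * d.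
    by rewrite kx_px ky_py /m /n /d; ring.
  rewrite sE.
  have : s * (1 - s) * d <= 0 by rewrite mulr_ge0_le0 // mulr_ge0 ?subr_ge0 ?(ltW s0).
  by have := mulr_gt0 s0 n0; lra.
have ba : b - a != 0.
  by apply: contra_neq a_neq0 => /subr0_eq ba; apply/eqP; rewrite -sqrf_eq0 eq_le sqr_ge0 andbT expr2 -{2}ba.
(* The zero of [(1 - s) a + s b], where the segment meets the line through 0 and [p]; it lies in the
   unit interval because [a b <= 0]. *)
pose s := - a / (b - a).
have sE : s * (b - a) = - a by rewrite divfK.
have s_gt0 : 0 < s.
  have : s * (b - a) ^+ 2 = a ^+ 2 - a * b by rewrite expr2 mulrA sE; ring.
  have : 0 < a ^+ 2 by rewrite lt_neqAle sqr_ge0 eq_sym sqrf_eq0 a_neq0.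
  have : 0 < (b - a) ^+ 2 by rewrite lt_neqAle sqr_ge0 eq_sym sqrf_eq0 ba.
  move=> h1 h2 h3; rewrite -(pmulr_lgt0 _ h1) h3; lra.
have s_le1 : s <= 1.
  have : (1 - s) * (b - a) ^+ 2 = b ^+ 2 - a * b.
    by rewrite expr2 mulrA mulrBl sE; ring.
  have : 0 <= b ^+ 2 by rewrite sqr_ge0.
  have : 0 < (b - a) ^+ 2 by rewrite lt_neqAle sqr_ge0 eq_sym sqrf_eq0 ba.
  move=> h1 h2 h3; rewrite -subr_ge0 -(pmulr_lge0 _ h1) h3; lra.
have s01 : 0 <= s <= 1 by rewrite (ltW s_gt0).
set qx := (1 - s) * kx + s * k3x; set qy := (1 - s) * ky + s * k3y.
pose e := px * qx + py * qy.
have eE : e = (1 - s) * n + s * d by rewrite /e /qx /qy /d -kn; ring.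
have cross : px * qy - py * qx = 0.
  transitivity (a + s * (b - a)); last by rewrite sE subrr.
  by rewrite /qx /qy /a /b; ring.
have qxE : n * qx = e * px.
  transitivity (e * px - (px * qy - py * qx) * py); last by rewrite cross; ring.
  by rewrite /e /n; ring.
have qyE : n * qy = e * py.
  transitivity (e * py + (px * qy - py * qx) * px); last by rewrite cross; ring.
  by rewrite /e /n; ring.
(* The crossing point is [q = (e / n) p], and [|q|^2 >= n] means [e^2 >= n^2]. Together with [e < n]
   this rules out [e > 0]. *)
have e2 : n ^+ 2 <= e ^+ 2.
  have -> : e ^+ 2 = n * (qx ^+ 2 + qy ^+ 2).
    transitivity (e ^+ 2 + (px * qy - py * qx) ^+ 2); first by rewrite cross; ring.
    by rewrite /e /n; ring.
  by rewrite expr2 ler_wpM2l ?(ltW n0) // hmin.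
have e_lt : e < n.
  have := mulr_gt0 s_gt0 n0; have : s * d <= 0 by rewrite mulr_ge0_le0 // ltW.
  by rewrite eE; lra.
have e_le0 : e <= 0.
  rewrite leNgt; apply/negP => e0; move: e2; apply/negP; rewrite -ltNge.
  by rewrite ltr_pXn2r ?nnegrE // ltW.
exists s, (- e / n); split=> //.
- by rewrite divr_ge0 ?oppr_ge0 // ltW.
- by apply: (mulfI n_neq0); rewrite mulr0 mulrDr qxE mulrA mulrCA mulfV //; ring.
- by apply: (mulfI n_neq0); rewrite mulr0 mulrDr qyE mulrA mulrCA mulfV //; ring.
Qed.

End Planar.

(** * Support characterization of the hull of a compact plane set *)

Section Hull.
Variable R : realType.
Implicit Types (S : set R[i]) (z w : R[i]).

(** Endpoints and parameter are packed into one tuple, so that a nearest point to 0 is a minimum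
    over a compact product. *)
Let segpt (q : (R * R) * (R * R) * R) : R * R :=
  ((1 - q.2) * q.1.1.1 + q.2 * q.1.2.1, (1 - q.2) * q.1.1.2 + q.2 * q.1.2.2).

(** Let [p] be the point nearest to 0 on all segments with ends in [K]. If [p] is not 0, some point
    of [K] has nonpositive projection on [p], and a segment joining it to a suitable end of the
    segment of [p] meets the ray opposite to [p]. So 0 is a positive combination of points on two
    segments. *)
Lemma compact_planar_hull (K : set (R * R)) : compact K ->
  (forall a b : R, exists2 k, K k & 0 <= a * k.1 + b * k.2) ->
  exists (k1 k2 k3 k4 : R * R) (t s r : R),
    [/\ [/\ K k1, K k2, K k3 & K k4], [/\ 0 <= t <= 1, 0 <= s <= 1 & 0 <= r],
      (1 - s) * k3.1 + s * k4.1 + r * ((1 - t) * k1.1 + t * k2.1) = 0 &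
      (1 - s) * k3.2 + s * k4.2 + r * ((1 - t) * k1.2 + t * k2.2) = 0].
Proof.
move=> cK hK.
pose f q := (segpt q).1 ^+ 2 + (segpt q).2 ^+ 2.
pose Q := (K `*` K) `*` `[0, 1]%classic : set ((R * R) * (R * R) * R).
have cQ : compact Q.
  by apply: compact_setX; [exact: compact_setX|exact: segment_compact].
have Q0 : Q !=set0.
  have [k Kk _] := hK 0 0; exists ((k, k), 0); split=> //=.
  by rewrite in_itv /= lexx ler01.
have cf : continuous f.
  move=> q; have c2 : (p.2 @[p --> q] --> q.2) by exact: cvg_snd.
  have c1 : (p.1 @[p --> q] --> q.1) by exact: cvg_fst.
  have c11 : (p.1.1 @[p --> q] --> q.1.1) by apply: cvg_comp c1 _; exact: cvg_fst.
  have c12 : (p.1.2 @[p --> q] --> q.1.2) by apply: cvg_comp c1 _; exact: cvg_snd.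
  have c111 : (p.1.1.1 @[p --> q] --> q.1.1.1).
    by apply: cvg_comp c11 _; exact: cvg_fst.
  have c112 : (p.1.1.2 @[p --> q] --> q.1.1.2).
    by apply: cvg_comp c11 _; exact: cvg_snd.
  have c121 : (p.1.2.1 @[p --> q] --> q.1.2.1).
    by apply: cvg_comp c12 _; exact: cvg_fst.
  have c122 : (p.1.2.2 @[p --> q] --> q.1.2.2).
    by apply: cvg_comp c12 _; exact: cvg_snd.
  have c1m : (1 - p.2 @[p --> q] --> 1 - q.2) by apply: cvgB => //; exact: cvg_cst.
  rewrite /f /segpt /=.
  by apply: cvgD; apply: cvgM; apply: cvgD; apply: cvgM.
have [[[k1 k2] t]] := compact_EVT_min Q0 cQ (continuous_subspaceT cf).
rewrite inE => -[[/= K1 K2]]; rewrite in_itv /= => /andP[t0 t1] fmin.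
have {}fmin k k' s : K k -> K k' -> 0 <= s <= 1 ->
    f ((k1, k2), t) <= ((1 - s) * k.1 + s * k'.1) ^+ 2 + ((1 - s) * k.2 + s * k'.2) ^+ 2.
  move=> Kk Kk' s01; apply: (fmin ((k, k'), s)); rewrite inE.
  by split; [split|rewrite /= in_itv].
set px := (1 - t) * k1.1 + t * k2.1; set py := (1 - t) * k1.2 + t * k2.2.
have fE : f ((k1, k2), t) = px ^+ 2 + py ^+ 2 by [].
rewrite fE in fmin; set n := px ^+ 2 + py ^+ 2 in fmin.
have t01 : 0 <= t <= 1 by rewrite t0.
have [n0|n_neq0] := eqVneq n 0.
  have /andP[/eqP px0 /eqP py0] : (px == 0) && (py == 0).
    by rewrite -[px == 0]sqrf_eq0 -[py == 0]sqrf_eq0 -paddr_eq0 ?sqr_ge0 // -/n n0.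
  exists k1, k2, k1, k2, t, t, 0; split=> //; rewrite mul0r addr0 //.
have n_gt0 : 0 < n by rewrite lt_neqAle eq_sym n_neq0 addr_ge0 ?sqr_ge0.
have [k3 K3 d3] := hK (- px) (- py).
have {}d3 : px * k3.1 + py * k3.2 <= 0 by lra.
pose cr (k : R * R) := px * k.2 - py * k.1.
pose dt (k : R * R) := px * k.1 + py * k.2.
have cr0 : (1 - t) * cr k1 + t * cr k2 = 0 by rewrite /cr /px /py; ring.
have dtn : (1 - t) * dt k1 + t * dt k2 = n by rewrite /dt /n /px /py; ring.
have finish k : K k -> dt k = n -> cr k * cr k3 <= 0 -> exists s r : R,
    [/\ 0 <= s <= 1, 0 <= r, (1 - s) * k.1 + s * k3.1 + r * px = 0 &
      (1 - s) * k.2 + s * k3.2 + r * py = 0].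
  by move=> Kk dk ck; apply: segment_crosses_opposite_ray => // s; exact: fmin.
suff [k [Kk dk ck]] : exists k, [/\ K k, dt k = n & cr k * cr k3 <= 0].
  have [s [r [s01 r0 h1 h2]]] := finish k Kk dk ck.
  by exists k1, k2, k, k3, t, s, r.
(* First-order optimality: a point of the segment with projection [m] below [n] would let a small
   step [h] towards it decrease the distance. The chosen [h] makes [2 h (m - n) + h^2 v]
   negative. *)
have opt s : 0 <= s <= 1 -> n <= (1 - s) * dt k1 + s * dt k2.
  move=> /andP[s0 s1].
  set m := (1 - s) * dt k1 + s * dt k2; rewrite leNgt; apply/negP => mn.
  pose v := (s - t) ^+ 2 * ((k2.1 - k1.1) ^+ 2 + (k2.2 - k1.2) ^+ 2).
  have v0 : 0 <= v by rewrite mulr_ge0 ?addr_ge0 ?sqr_ge0.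
  have hh h : 0 <= h <= 1 -> 0 <= 2 * h * (m - n) + h ^+ 2 * v.
    move=> /andP[h0 h1]; have := fmin k1 k2 ((1 - h) * t + h * s) K1 K2.
    have -> : 0 <= (1 - h) * t + h * s <= 1.
      apply/andP; split; first by rewrite addr_ge0 ?mulr_ge0 ?subr_ge0.
      have : (1 - h) * t <= (1 - h) * 1 by rewrite ler_wpM2l ?subr_ge0.
      have : h * s <= h * 1 by rewrite ler_wpM2l.
      lra.
    move=> /(_ isT); rewrite -subr_ge0; congr (0 <= _).
    by rewrite /v /m -dtn /n /dt /px /py; ring.
  pose h := (n - m) / (n - m + v).
  have hE : h * (n - m + v) = n - m by rewrite divfK //; lra.
  have h0 : 0 < h by rewrite divr_gt0 //; lra.
  have h1 : h <= 1 by rewrite ler_pdivrMr; lra.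
  have := hh h; rewrite h1 (ltW h0) => /(_ isT).
  have -> : 2 * h * (m - n) + h ^+ 2 * v =
    h * (h * (n - m + v)) - h ^+ 2 * (n - m) - 2 * h * (n - m) by ring.
  rewrite hE; have := mulr_gt0 h0 (_ : 0 < n - m).
  have : 0 < h ^+ 2 * (n - m) by rewrite mulr_gt0 ?exprn_gt0 //; lra.
  by move=> + /(_ ltac:(lra)); lra.
have d1 : n <= dt k1 by have := opt 0; rewrite subr0 mul1r mul0r addr0 lexx ler01; apply.
have d2 : n <= dt k2 by have := opt 1; rewrite subrr mul0r mul1r add0r lexx ler01; apply.
(* If [p] is an end of its segment, that end has cross product 0. Otherwise both projections are at
   least [n] with weighted mean [n], hence equal [n], and the weighted cross products cancel, so one
   end lies weakly on the side of the line through [p] opposite to [k3]. *)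
have [t_eq0|t_neq0] := eqVneq t 0.
  exists k1; split=> //; first by move: dtn; rewrite t_eq0; lra.
  by move: cr0; rewrite t_eq0 subr0 mul1r mul0r addr0 => ->; rewrite mul0r.
have [t_eq1|t_neq1] := eqVneq t 1.
  exists k2; split=> //; first by move: dtn; rewrite t_eq1; lra.
  by move: cr0; rewrite t_eq1 subrr mul1r mul0r add0r => ->; rewrite mul0r.
have t_gt0 : 0 < t by rewrite lt_neqAle eq_sym t_neq0.
have t_lt1 : 0 < 1 - t by rewrite subr_gt0 lt_neqAle t_neq1.
have e1 : 0 <= (1 - t) * (dt k1 - n) by rewrite mulr_ge0 ?subr_ge0.
have e2 : 0 <= t * (dt k2 - n) by rewrite mulr_ge0 ?subr_ge0.
have e3 : (1 - t) * (dt k1 - n) + t * (dt k2 - n) = 0.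
  by rewrite -(subrr n) -{3}dtn; ring.
have dt1 : dt k1 = n.
  apply/eqP; rewrite -subr_eq0 -(mulrI_eq0 _ (lregP (lt0r_neq0 t_lt1))).
  by apply/eqP; lra.
have dt2 : dt k2 = n.
  apply/eqP; rewrite -subr_eq0 -(mulrI_eq0 _ (lregP (lt0r_neq0 t_gt0))).
  by apply/eqP; lra.
have [c1|c1] := lerP (cr k1 * cr k3) 0; first by exists k1.
exists k2; split=> //; rewrite -(pmulr_rle0 _ t_gt0) mulrA.
have -> : t * cr k2 = - ((1 - t) * cr k1) by lra.
by rewrite mulNr oppr_le0 -mulrA mulr_ge0 // ltW.
Qed.

(* [S] is translated by [- z] and read in real coordinates, so that the
   compactness of the product topology on [R * R] applies. *)
Lemma closed_convex_hull_support S z (M : R) :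
  (forall w, (forall e : R, 0 < e -> exists2 w', S w' & normc (w - w') < e) -> S w) ->
  (forall w, S w -> normc w <= M) ->
  (forall u, normc u = 1 -> exists2 w, S w &
    complex.Re (conjc u * z) <= complex.Re (conjc u * w)) ->
  convex_hull S z.
Proof.
move=> Scl SM hS.
pose tr (k : R * R) : R[i] := (k.1 +i* k.2) + z.
pose K : set (R * R) := [set k | S (tr k)].
have normcRI (a b : R) : normc (a +i* b) <= `|a| + `|b|.
  rewrite -(@ler_pXn2r _ 2) ?nnegrE ?normc_ge0 ?addr_ge0 //= sqr_sqrtr ?addr_ge0 ?sqr_ge0 //.
  rewrite -(real_normK (num_real a)) -(real_normK (num_real b)).
  by have := mulr_ge0 (normr_ge0 a) (normr_ge0 b); lra.
have clK : closed K.
  move=> k hk; apply: Scl => e e0.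
  have [k' [Kk' [b1 b2]]] := hk _ (nbhsx_ballx k (e / 2) (divr_gt0 e0 (ltr0n _ 2))).
  exists (tr k') => //.
  have -> : tr k - tr k' = (k.1 - k'.1) +i* (k.2 - k'.2).
    by rewrite /tr opprD addrACA subrr addr0.
  apply: le_lt_trans (normcRI _ _) _.
  by move: b1 b2; rewrite /ball /=; lra.
have bdK : K `<=` `[- (M + normc z), M + normc z]%classic `*`
                  `[- (M + normc z), M + normc z]%classic.
  move=> k /SM hk; have {}hk : normc (k.1 +i* k.2) <= M + normc z.
    have -> : k.1 +i* k.2 = tr k - z by rewrite /tr addrK.
    by apply: le_trans (ler_normcB _ _) _; rewrite lerD2r.
  split; rewrite /= in_itv /= -ler_norml; apply: le_trans hk; rewrite /= -sqrtr_sqr.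
    by rewrite ler_sqrt ?addr_ge0 ?sqr_ge0 // lerDl sqr_ge0.
  by rewrite ler_sqrt ?addr_ge0 ?sqr_ge0 // lerDr sqr_ge0.
have cK : compact K.
  by apply: subclosed_compact clK _ bdK; apply: compact_setX; exact: segment_compact.
have hK (a b : R) : exists2 k, K k & 0 <= a * k.1 + b * k.2.
  have [w0 Sw0 _] : exists2 w, S w & complex.Re (conjc 1 * z) <= complex.Re (conjc 1 * w).
    by apply: hS; rewrite normc1.
  have KS w : S w -> K (complex.Re (w - z), complex.Im (w - z)).
    rewrite /K /tr /=; case: (w - z) (subrK z w) => p q /= pqE.
    by rewrite pqE.
  have [ab0|ab_neq0] := eqVneq (a +i* b) 0.
    case: ab0 => -> ->; exists (complex.Re (w0 - z), complex.Im (w0 - z)); first exact: KS.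
    by rewrite !mul0r addr0.
  pose c := normc (a +i* b).
  have c0 : 0 < c.
    rewrite lt_neqAle normc_ge0 andbT eq_sym; apply: contra_neq ab_neq0.
    exact: eq0_normc.
  have [|w Sw] := hS (c^-1%:C * (a +i* b)).
    by rewrite normcM normc_real -/c ger0_norm ?invr_ge0 ?(ltW c0) // mulVf // gt_eqF.
  rewrite -subr_ge0 -ReB -mulrBr => hw.
  exists (complex.Re (w - z), complex.Im (w - z)); first exact: KS.
  move: hw; case: (w - z) => p q /=.
  rewrite !mul0r !subr0 ?addr0 => hw.
  have : 0 <= c^-1 * (a * p + b * q) by move: hw; rewrite mulrDr; lra.
  by rewrite pmulr_rge0 // invr_gt0.
have [k1 [k2 [k3 [k4 [t [s [r [[K1 K2 K3 K4] [t01 s01 r0] h1 h2]]]]]]]] :=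
  compact_planar_hull cK hK.
have r1 : 0 < 1 + r by lra.
(* Dividing the vanishing combination by [1 + r] turns it into a convex one. *)
pose r' := r / (1 + r).
have r'E : r' * (1 + r) = r by rewrite divfK // gt_eqF.
have r'01 : 0 <= r' <= 1.
  by rewrite divr_ge0 ?(ltW r1) //= ler_pdivrMr // mul1r; lra.
have -> : z = (1 - r')%:C * ((1 - s)%:C * tr k3 + s%:C * tr k4)
    + r'%:C * ((1 - t)%:C * tr k1 + t%:C * tr k2).
  have r'r : 1 - r' = (1 + r)^-1 by rewrite /r'; field; lra.
  have r'r2 : r' = (1 + r)^-1 * r by rewrite /r' mulrC.
  (* Used to insert the vanishing combination, scaled by [(1 + r)^-1], into each coordinate. *)
  have /eqP e : 0 == (1 + r)^-1 * 0 :> R by rewrite mulr0.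
  apply/eqP; rewrite r'r r'r2 /tr; case: (z) => p q; rewrite eq_complex /=.
  rewrite !mul0r !subr0 ?addr0; apply/andP; split; apply/eqP.
    rewrite -[LHS]addr0 {1}e -h1; field; lra.
  rewrite -[LHS]addr0 {1}e -h2; field; lra.
by do !apply: convex_hull_conv => //; exact: sub_convex_hull.
Qed.

End Hull.

(** * The equality of the maximal numerical range and the hull *)

Unset Implicit Arguments.

Theorem theorem4 (R : realType) (H : lmodType R[i]) (ip : H -> H -> R[i])
  (A : H -> H) :
  is_hilbert ip ->
  (exists x : H, x != 0) ->
  linear_op A -> bounded_op ip A -> normal_op ip A ->
  max_num_range ip A =
    convex_hull (spectrum ip A `&` norm_circle ip A).
Proof.
move=> [ipP cpl] H0 lA bA nA; have [S [adj com]] := nA.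
have M0 := opnorm_ge0 ipP lA bA H0; set M := opnorm ip A in M0.
pose K : set R[i] := [set w | approx_eigenvalue ip A w /\ normc w = M].
have -> : spectrum ip A `&` norm_circle ip A = K.
  apply/seteqP; split=> w [sw cw]; split.
  - exact: spectrum_approx_eigenvalue.
  - exact: complexI.
  - exact: approx_eigenvalue_spectrum.
  - by rewrite /norm_circle /= normC_normc cw.
apply/seteqP; split=> [v Wv|_ [n [c [w [wK c0 c1 ->]]]]].
  apply: (@closed_convex_hull_support _ _ _ M).
  (* Closedness: an approximate eigenvector for a nearby [w'] also serves [w], with error increased
     by [|w - w'|]. *)
  - move=> w hw; split.
      move=> e e0; have [|w' [aw' _] ww'] := hw (e / 2); first by lra.
      have [|x [x1 hx]] := aw' (e / 2); first by lra.
      exists x; split=> //.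
      have -> : shift_op A w x = shift_op A w' x - (w - w') *: x.
        by rewrite /shift_op scalerBl opprB addrA subrK.
      apply: le_lt_trans (hnormB ipP _ _) _; rewrite hnormZ // x1; lra.
    apply/eqP; rewrite eq_le; apply/andP; split; apply/ler_addgt0Pl => e e0.
      have [w' [_ w'M] ww'] := hw e e0.
      by have := ler_normcD (w - w') w'; rewrite subrK w'M; lra.
    have [w' [_ w'M] ww'] := hw e e0.
    have := ler_normcB w (w - w'); rewrite opprB addrC subrK w'M; lra.
  - by move=> w [_ ->].
  - move=> u u1; have [w [aw wM uw]] := max_num_range_support ipP adj com lA bA M0 u1 Wv.
    by exists w.
(* The points [w i] may repeat, while near orthogonality requires distinct values; [I] is the type
   of distinct values, and [c'] merges the weights of equal points. *)
pose I := seq_sub (codom w).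
pose c' (k : I) := \sum_(i | w i == val k) c i.
pose p (i : 'I_n) : I := SeqSub (codom_f w i).
have part (V : nmodType) (F : 'I_n -> V) :
    \sum_i F i = \sum_(k : I) \sum_(i | w i == val k) F i.
  by rewrite (partition_big p xpredT).
have -> : \sum_i (c i)%:C * w i = \sum_(k : I) (c' k)%:C * val k.
  rewrite part; apply: eq_bigr => k _; rewrite /c' rmorph_sum mulr_suml /=.
  by apply: eq_bigr => i /eqP ->.
have wK' (k : I) : K (val k).
  by case: k => k /= /codomP[i ->].
apply: (approx_hull_max_num_range ipP adj com lA bA M0) => [|k|k|k|].
- exact: val_inj.
- by case: (wK' k).
- by case: (wK' k).
- exact: sumr_ge0.
- by rewrite /c' -part.
Qed.
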